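(* Let $\alpha,\beta>0$ and consider the asymmetric annihilation process on $L$ sites, with $\xi_{m,n}=\frac{1-\xi_m\xi_n}{2}$, where $\xi_i=\prod_{j=1}^i(1-2\eta_j)$ and $\xi_0=1$. Then in the stationary state, for integers $0\le n\le m<L$, $$\langle\xi_{m,n}\rangle=\frac{\alpha}{2^{(m+n-2)_+}(1+2\alpha)^m}\sum_{j=0}^{m-1}(1+2\alpha)^j\,2^{(m-j-2)_+}\sum_{k=1}^{m-n}\binom{(m+n-2)_+-(m-j-2)_+}{m-k},$$ and if $L>n>m$, then $\xi_{m,n}=\xi_{n,m}$.
   Context: The model: a continuous-time Markov chain on configurations $\eta=(\eta_1,\dots,\eta_L)\in\{0,1\}^L$ ($\eta_i=1$ if site $i$ is occupied, $0$ if empty), with parameters $\alpha,\beta>0$ and the following transitions. Bulk: for each pair of neighbouring sites $(i,i+1)$, $1\le i\le L-1$, $10\to 01$ with rate $1$ and $11\to 00$ with rate $1$. Left boundary: at site $1$, $0\to 1$ with rate $\alpha$ and $1\to 0$ with rate $\alpha$. Right boundary: at site $L$, $1\to0$ with rate $\beta$. The bracket $\langle\cdot\rangle$ denotes expectation with respect to the unique stationary distribution of this chain. Notation: $n_+=n$ if $n\ge0$ and $n_+=0$ otherwise. Binomial coefficients $\binom{a}{b}$ with integers $a\ge0$, $b\ge 0$ are zero if $b>a$; empty sums are zero. *)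

(* Defs.v *)
From HB Require Import structures.
From mathcomp Require Import all_boot all_order all_algebra.
From mathcomp Require Import reals.

Set Implicit Arguments.
Unset Strict Implicit.
Unset Printing Implicit Defensive.

Import Order.TTheory GRing.Theory Num.Theory.
Local Open Scope ring_scope.

(* Configurations of {0,1}^L.  Site i (1 <= i <= L) is encoded as
   the ordinal of value i - 1, and [eta i = true] means that it is occupied. *)
Definition config (L : nat) := {ffun 'I_L -> bool}.

Definition set_site (L : nat) (eta : config L) (i : 'I_L) (b : bool) : config L :=
  [ffun k => if k == i then b else eta k].

(* Jump rates of the asymmetric annihilation process.  The contributions of the
   bulk and of the two boundaries are added, so that two distinct mechanisms
   producing the same jump (as for L = 1) have their rates summed. *)
Definition bulk_rate (R : realType) (L : nat) (eta zeta : config L) : R :=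
  \sum_(i < L) \sum_(j < L | j == i.+1 :> nat)
    (([&& eta i, ~~ eta j
        & zeta == set_site (set_site eta i false) j true])%:R
     + ([&& eta i, eta j
          & zeta == set_site (set_site eta i false) j false])%:R).

Definition left_rate (R : realType) (L : nat) (alpha : R)
    (eta zeta : config L) : R :=
  \sum_(i < L | i == 0%N :> nat)
    (alpha * (~~ eta i && (zeta == set_site eta i true))%:R
     + alpha * (eta i && (zeta == set_site eta i false))%:R).

Definition right_rate (R : realType) (L : nat) (beta : R)
    (eta zeta : config L) : R :=
  \sum_(i < L | i.+1 == L :> nat)
    beta * (eta i && (zeta == set_site eta i false))%:R.

Definition rate (R : realType) (L : nat) (alpha beta : R)
    (eta zeta : config L) : R :=
  bulk_rate R eta zeta + left_rate alpha eta zeta + right_rate beta eta zeta.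

Definition generator (R : realType) (L : nat) (alpha beta : R)
    (eta zeta : config L) : R :=
  rate alpha beta eta zeta
  - (eta == zeta)%:R * \sum_(tau : config L) rate alpha beta eta tau.

Definition is_distribution (R : realType) (L : nat) (pi : config L -> R) : Prop :=
  (forall eta, 0 <= pi eta) /\ \sum_(eta : config L) pi eta = 1.

Definition stationary (R : realType) (L : nat) (alpha beta : R)
    (pi : config L -> R) : Prop :=
  is_distribution pi /\
  forall zeta : config L,
    \sum_(eta : config L) pi eta * generator alpha beta eta zeta = 0.

Definition expectation (R : realType) (L : nat) (pi f : config L -> R) : R :=
  \sum_(eta : config L) pi eta * f eta.

(* The ordinals j < i are the sites 1, ..., i; only i <= L is meaningful. *)
Definition xi (R : realType) (L : nat) (i : nat) (eta : config L) : R :=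
  \prod_(j < L | (j < i)%N) (1 - 2 * (eta j)%:R).

Definition xi2 (R : realType) (L : nat) (m n : nat) (eta : config L) : R :=
  (1 - xi R m eta * xi R n eta) / 2.

(* Main.v *)
(** In the variables [xi_i] the dynamics is a voter model: for [1 <= i < L] the
    spin [xi_i] copies [xi_(i-1)] at rate [1], with [xi_0 = 1], while the left
    boundary flips [xi_1, ..., xi_L] simultaneously at rate [alpha] and the right
    boundary only affects [xi_L].  Stationarity applied to [xi_m xi_n] thus gives,
    for [x(m,n) = <xi_(m,n)>],
      [(1 + 2 alpha) x(m,0) = x(m-1,0) + alpha],
      [2 x(m,n) = x(m-1,n) + x(m,n-1)] for [0 < n < m],  [x(m,m) = 0],
    and the closed form satisfies the same recursion by Pascal's rule. *)
Require Import Defs.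
From HB Require Import structures.
From mathcomp Require Import all_boot all_order all_algebra.
From mathcomp Require Import reals.
From mathcomp Require Import zify ring lra.

Set Implicit Arguments.
Unset Strict Implicit.
Unset Printing Implicit Defensive.

Import Order.TTheory GRing.Theory Num.Theory.
Local Open Scope ring_scope.

Lemma sum_rate_pred1 (R : pzRingType) (T : finType) (x : T) (c : R) (g : T -> R) :
  \sum_(z : T) (c * (z == x)%:R) * g z = c * g x.
Proof.
rewrite (bigD1 x) //= eqxx mulr1 big1 ?addr0 // => z /negPf->.
by rewrite mulr0 mul0r.
Qed.

Definition flip_site (L : nat) (eta : config L) (i : 'I_L) : config L :=
  set_site eta i (~~ eta i).

(** * Spin variables and the action of the dynamics on products of two spins *)

Section Spins.
Variables (R : realType) (L : nat).
Implicit Types (eta zeta : config L) (i j : 'I_L) (m n : nat).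

Lemma xi0 eta : xi R 0 eta = 1.
Proof. by rewrite /xi big_pred0. Qed.

Lemma xiS eta i : xi R i.+1 eta = xi R i eta * (1 - 2 * (eta i)%:R).
Proof.
rewrite /xi (bigD1 i) //= mulrC; congr (_ * _); apply: eq_bigl => j.
by rewrite ltnS [RHS]ltn_neqAle andbC.
Qed.

Lemma xi_sqr m eta : xi R m eta * xi R m eta = 1.
Proof.
rewrite /xi -big_split big1 // => j _.
by case: (eta j); rewrite /=; ring.
Qed.

Lemma xi_flip m eta i : xi R m (flip_site eta i) = (-1) ^+ (i < m)%N * xi R m eta.
Proof.
have flipE j : 1 - 2 * (flip_site eta i j)%:R
    = (-1) ^+ (j == i) * (1 - 2 * (eta j)%:R) :> R.
  rewrite /flip_site /set_site ffunE; case: eqP => [->|_]; last by rewrite mul1r.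
  by case: (eta i); rewrite /=; ring.
rewrite /xi (eq_bigr _ (fun j _ => flipE j)) big_split; congr (_ * _).
case: ltnP => [lt_im|le_mi].
  by rewrite (bigD1 i) //= eqxx big1 ?mulr1 // => j /andP[_ /negPf->].
by rewrite big1 // => j lt_jm; case: eqP => // ji; move: lt_jm; rewrite ji ltnNge le_mi.
Qed.

(** An occupied site is a domain wall: the spins on its two sides have opposite signs. *)
Lemma occupation_xi eta i :
  (eta i)%:R = (1 - xi R i eta * xi R i.+1 eta) / 2.
Proof. by rewrite xiS mulrA xi_sqr; case: (eta i); rewrite /=; lra. Qed.

Lemma xi2_sym m n eta : xi2 R m n eta = xi2 R n m eta.
Proof. by rewrite /xi2 [xi _ m _ * _]mulrC. Qed.

(** Both bulk moves, 10 to 01 and 11 to 00, flip the two sites and only require the left one to be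
    occupied. Having equal rates, they merge into one double flip. *)
Lemma bulk_rate_sum eta (g : config L -> R) :
  \sum_zeta bulk_rate R eta zeta * g zeta
  = \sum_(i < L) \sum_(j < L | j == i.+1 :> nat)
      (eta i)%:R * g (flip_site (flip_site eta i) j).
Proof.
under eq_bigr => zeta _ do rewrite /bulk_rate mulr_suml.
rewrite exchange_big; apply: eq_bigr => i _ /=.
under eq_bigr => zeta _ do rewrite mulr_suml.
rewrite exchange_big; apply: eq_bigr => j /eqP ji /=.
rewrite -sum_rate_pred1; apply: eq_bigr => zeta _; congr (_ * _).
have /negPf ne_ji : j != i by apply/eqP => eji; move: ji; rewrite eji; lia.
have flip_j : flip_site eta i j = eta j by rewrite ffunE ne_ji.
rewrite {1}/flip_site flip_j /flip_site.
by case: (eta i); case: (eta j); rewrite /= ?mul0r ?addr0 ?add0r ?mul1r.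
Qed.

(** Creation and annihilation at site 1 share the rate [alpha], so the flip does not depend on
    [eta]. *)
Lemma left_rate_sum alpha eta (g : config L -> R) :
  \sum_zeta left_rate alpha eta zeta * g zeta
  = \sum_(i < L | i == 0%N :> nat) alpha * g (flip_site eta i).
Proof.
under eq_bigr => zeta _ do rewrite /left_rate mulr_suml.
rewrite exchange_big; apply: eq_bigr => i _ /=.
rewrite -sum_rate_pred1; apply: eq_bigr => zeta _; congr (_ * _).
by rewrite /flip_site; case: (eta i); rewrite /= ?mulr0 ?addr0 ?add0r.
Qed.

Lemma right_rate_sum beta eta (g : config L -> R) :
  \sum_zeta right_rate beta eta zeta * g zeta
  = \sum_(i < L | i.+1 == L :> nat) beta * (eta i)%:R * g (flip_site eta i).
Proof.
under eq_bigr => zeta _ do rewrite /right_rate mulr_suml.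
rewrite exchange_big; apply: eq_bigr => i _ /=.
rewrite -sum_rate_pred1; apply: eq_bigr => zeta _; congr (_ * _).
by rewrite /flip_site; case: (eta i); rewrite /= ?mulr0 ?mul0r ?mulr1.
Qed.

(** Pair the stationarity equation with [f] and exchange the two sums; the diagonal of the generator
    produces the term [- f eta]. *)
Lemma stationary_rate alpha beta (pi f : config L -> R) :
  stationary alpha beta pi ->
  expectation pi
    (fun eta => \sum_zeta rate alpha beta eta zeta * (f zeta - f eta)) = 0.
Proof.
case=> _ pi_inv.
transitivity (\sum_zeta
    (\sum_eta pi eta * generator alpha beta eta zeta) * f zeta); last first.
  by apply: big1 => zeta _; rewrite pi_inv mul0r.
under [RHS]eq_bigr => zeta _ do rewrite mulr_suml.
rewrite exchange_big /expectation; apply: eq_bigr => eta _ /=.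
under [RHS]eq_bigr => zeta _ do rewrite -mulrA.
rewrite -mulr_sumr; congr (_ * _).
under eq_bigr => zeta _ do rewrite mulrBr.
rewrite sumrB -mulr_suml.
under [RHS]eq_bigr => zeta _ do rewrite /generator mulrBl.
rewrite sumrB; congr (_ - _).
rewrite -(sum_rate_pred1 eta _ f); apply: eq_bigr => zeta _.
by rewrite [(eta == zeta)]eq_sym [_%:R * _]mulrC.
Qed.

(** A double flip reverses a single spin, so for [m != n] at most one factor changes. It occurs only
    at a domain wall, where reversing a spin amounts to copying its left neighbour. *)
Lemma bulk_rate_xi m n eta : m != n -> (m < L)%N -> (n < L)%N ->
  \sum_zeta bulk_rate R eta zeta
      * (xi R m zeta * xi R n zeta - xi R m eta * xi R n eta)
  = (if m is m'.+1 then xi R m' eta - xi R m eta else 0) * xi R n eta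
    + xi R m eta * (if n is n'.+1 then xi R n' eta - xi R n eta else 0).
Proof.
move=> ne_mn lt_mL lt_nL; rewrite (bulk_rate_sum _
  (fun zeta => xi R m zeta * xi R n zeta - xi R m eta * xi R n eta)).
pose occ k : R := \sum_(i < L | i.+1 == k) (eta i)%:R.
have occE k : (k < L)%N -> -2 * xi R k eta * occ k
    = if k is k'.+1 then xi R k' eta - xi R k eta else 0.
  case: k => [|k] lt_kL; first by rewrite /occ big_pred0 ?mulr0.
  rewrite /occ (big_pred1 (Ordinal (ltnW lt_kL))); last first.
    by move=> i /=; rewrite eqSS -val_eqE.
  by rewrite occupation_xi /=; have := xi_sqr k.+1 eta; set x := xi R k.+1 eta;
    move=> x2; field: x2.
rewrite -!occE //.
transitivity (\sum_(i < L)
   ((-2 * xi R m eta * xi R n eta) * ((i.+1 == m)%:R * (eta i)%:R)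
   + (-2 * xi R m eta * xi R n eta) * ((i.+1 == n)%:R * (eta i)%:R))).
  apply: eq_bigr => i _; case: (ltnP i.+1 L) => [lt_iL|le_Li].
    rewrite (big_pred1 (Ordinal lt_iL)); last by move=> j /=; rewrite -val_eqE.
    rewrite !xi_flip /=.
    (* The two signs cancel unless [k] separates the flipped sites, that is [k = i.+1]. *)
    have flipE k : (-1) ^+ (i.+1 < k)%N * ((-1) ^+ (i < k)%N * xi R k eta)
        = (1 - 2 * (i.+1 == k)%:R) * xi R k eta.
      by rewrite [in (i < k)%N]leq_eqVlt; case: ltngtP => _ /=; ring.
    rewrite !flipE; case: eqP => [im|_]; case: eqP => [i_n|_] /=; try ring.
    by move: ne_mn; rewrite -im -i_n eqxx.
  (* The last site has no right neighbour, and its indicators vanish because [m] and [n] are below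
     [L]. *)
  rewrite big_pred0; last by move=> j; apply/eqP; have := ltn_ord j; lia.
  have /negPf-> : i.+1 != m by lia.
  have /negPf-> : i.+1 != n by lia.
  by rewrite !mul0r !mulr0 addr0.
have occ_sum k : \sum_(i < L) (i.+1 == k)%:R * (eta i)%:R = occ k.
  by rewrite /occ [RHS]big_mkcond; apply: eq_bigr => i _;
    case: eqP => _; rewrite ?mul1r ?mul0r.
by rewrite big_split -!mulr_sumr !occ_sum /=; ring.
Qed.

(** Flipping site 1 reverses every spin except [xi_0], so the product changes sign only when exactly
    one index is zero. *)
Lemma left_rate_xi alpha m n eta : (m < L)%N -> (n < L)%N ->
  \sum_zeta left_rate alpha eta zeta
      * (xi R m zeta * xi R n zeta - xi R m eta * xi R n eta)
  = ((-1) ^+ ((0 < m)%N (+) (0 < n)%N) - 1) * alpha * (xi R m eta * xi R n eta).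
Proof.
move=> lt_mL lt_nL; rewrite (left_rate_sum _ _
  (fun zeta => xi R m zeta * xi R n zeta - xi R m eta * xi R n eta)).
have lt_0L : (0 < L)%N by lia.
rewrite (big_pred1 (Ordinal lt_0L)); last by move=> i /=; rewrite -val_eqE.
by rewrite !xi_flip /= signr_addb; ring.
Qed.

Lemma right_rate_xi beta m n eta : (m < L)%N -> (n < L)%N ->
  \sum_zeta right_rate beta eta zeta
      * (xi R m zeta * xi R n zeta - xi R m eta * xi R n eta) = 0.
Proof.
move=> lt_mL lt_nL; rewrite (right_rate_sum _ _
  (fun zeta => xi R m zeta * xi R n zeta - xi R m eta * xi R n eta)).
apply: big1 => i /eqP iL; rewrite !xi_flip.
have -> : (i < m)%N = false by lia.
have -> : (i < n)%N = false by lia.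
by ring.
Qed.

(** * Recursion for the stationary two-point functions *)

Section Stationary.
Variables (alpha beta : R) (pi : config L -> R).
Hypothesis pi_stationary : stationary alpha beta pi.

Let corr m n := expectation pi (fun eta => xi R m eta * xi R n eta).

Lemma expectation_xi2 m n : expectation pi (xi2 R m n) = (1 - corr m n) / 2.
Proof.
case: pi_stationary => -[_ pi1] _; rewrite -[X in X - _]pi1 /corr /expectation -sumrB mulr_suml.
by apply: eq_bigr => eta _; rewrite /xi2; field.
Qed.

Lemma expectation_xi2_diag m : expectation pi (xi2 R m m) = 0.
Proof.
by apply: big1 => eta _; rewrite /xi2 xi_sqr subrr mul0r mulr0.
Qed.

Lemma stationary_xi m n : m != n -> (m < L)%N -> (n < L)%N ->
  expectation pi (fun eta =>
    (if m is m'.+1 then xi R m' eta - xi R m eta else 0) * xi R n eta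
    + xi R m eta * (if n is n'.+1 then xi R n' eta - xi R n eta else 0)
    + ((-1) ^+ ((0 < m)%N (+) (0 < n)%N) - 1) * alpha
       * (xi R m eta * xi R n eta)) = 0.
Proof.
move=> ne_mn lt_mL lt_nL.
rewrite -[RHS](stationary_rate (fun eta => xi R m eta * xi R n eta) pi_stationary).
apply: eq_bigr => eta _; congr (_ * _).
under [RHS]eq_bigr => zeta _ do rewrite /rate !mulrDl.
by rewrite !big_split /= bulk_rate_xi // left_rate_xi // right_rate_xi // addr0.
Qed.

(** With [xi_0 = 1] the left flip contributes [-2 * alpha] to the equation for [corr m.+1 0]; the
    inhomogeneous [alpha] appears on passing from [corr] to [(1 - corr) / 2]. *)
Lemma expectation_xi2_boundary m : (m.+1 < L)%N ->
  (1 + 2 * alpha) * expectation pi (xi2 R m.+1 0)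
  = expectation pi (xi2 R m 0) + alpha.
Proof.
move=> lt_mL.
have := stationary_xi (isT : m.+1 != 0)%N lt_mL
  (leq_ltn_trans (leq0n _) lt_mL).
rewrite !expectation_xi2 => E.
suff : corr m 0 - (1 + 2 * alpha) * corr m.+1 0 = 0 by move=> H; lra.
rewrite -[RHS]E /corr /expectation mulr_sumr -sumrB; apply: eq_bigr => eta _ /=.
by rewrite xi0 /=; ring.
Qed.

(** Both indices are positive, so the left flip preserves the product and [alpha] drops out. *)
Lemma expectation_xi2_bulk m n : (n < m)%N -> (m.+1 < L)%N ->
  2 * expectation pi (xi2 R m.+1 n.+1)
  = expectation pi (xi2 R m n.+1) + expectation pi (xi2 R m.+1 n).
Proof.
move=> lt_nm lt_mL.
have ne_mn : m.+1 != n.+1 by lia.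
have := stationary_xi ne_mn lt_mL (leq_trans (lt_nm : (n.+1 < m.+1)%N) (ltnW lt_mL)).
rewrite !expectation_xi2 => E.
suff : corr m n.+1 + corr m.+1 n - 2 * corr m.+1 n.+1 = 0 by move=> H; lra.
rewrite -[RHS]E /corr /expectation mulr_sumr -big_split -sumrB.
by apply: eq_bigr => eta _ /=; ring.
Qed.

End Stationary.
End Spins.

(** * The closed form satisfies the same recursion *)

Section ClosedForm.
Variables (R : realType) (alpha : R).

Definition xi2_formula (m n : nat) : R :=
  alpha / (2 ^+ (m + n - 2) * (1 + 2 * alpha) ^+ m)
  * \sum_(0 <= j < m)
      ((1 + 2 * alpha) ^+ j * 2 ^+ (m - j - 2)
       * \sum_(1 <= k < (m - n).+1)
           ('C((m + n - 2) - (m - j - 2), m - k))%:R).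

Lemma xi2_formula_diag m : xi2_formula m m = 0.
Proof.
rewrite /xi2_formula [X in _ * X]big1 ?mulr0 // => j _.
by rewrite subnn big_geq ?mulr0.
Qed.

(** As [m - k] runs over [0, ..., m - 1], it meets every nonzero entry of row [N] of Pascal's
    triangle. *)
Lemma sum_bin_rev N m : (N < m)%N ->
  (\sum_(1 <= k < m.+1) 'C(N, m - k) = 2 ^ N)%N.
Proof.
move=> lt_Nm; rewrite big_add1 /= -[2%N]/(1 + 1)%N expnDn big_mkord.
rewrite (reindex_inj rev_ord_inj) /=.
rewrite -(big_mkord xpredT (fun i => 'C(N, m - (m - i.+1).+1))).
rewrite (big_cat_nat (n := N.+1)) //= -[RHS]addn0; congr addn.
  rewrite big_mkord; apply: eq_bigr => i _; rewrite !exp1n !muln1.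
  by congr 'C(_, _); have := ltn_ord i; lia.
rewrite big_nat big1 // => i /andP[lt_Ni lt_im].
by rewrite bin_small //; lia.
Qed.

(** Pascal's rule gives two sums over the same range; the last term ['C(N, q)] of one is then moved
    to the end of the other. *)
Lemma sum_bin_pascal N p q : (q < p)%N ->
  (\sum_(1 <= k < (p - q).+1) 'C(N.+1, p.+1 - k)
   = \sum_(1 <= k < p - q) 'C(N, p - k)
     + \sum_(1 <= k < (p.+1 - q).+1) 'C(N, p.+1 - k))%N.
Proof.
move=> lt_qp; have [t def_p] : exists t, p = (q + t).+1 by exists (p - q.+1)%N; lia.
subst p.
have -> : ((q + t).+1 - q = t.+1)%N by lia.
have -> : ((q + t).+2 - q = t.+2)%N by lia.
transitivity (\sum_(1 <= k < t.+2)
   ('C(N, (q + t).+2 - k) + 'C(N, (q + t).+1 - k)))%N.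
  apply: eq_big_nat => k /andP[k1 kt].
  have -> : ((q + t).+2 - k = ((q + t).+1 - k).+1)%N by lia.
  by rewrite binS.
rewrite big_split /= [X in (_ + X)%N]big_nat_recr //=.
rewrite [X in _ = (_ + X)%N]big_nat_recr //=.
have -> : ((q + t).+1 - t.+1 = (q + t).+2 - t.+2)%N by lia.
by lia.
Qed.

Hypothesis alpha_gt0 : 0 < alpha.

Let a_neq0 : 1 + 2 * alpha != 0.
Proof. by rewrite lt0r_neq0 // addr_gt0 ?mulr_gt0. Qed.

(** For [n = 0] the inner sum covers a full binomial row; its power of 2 completes
    [2 ^+ (m - j - 2)] to [2 ^+ (m - 2)], which cancels the prefactor. *)
Lemma xi2_formula0 m :
  xi2_formula m 0
  = alpha / (1 + 2 * alpha) ^+ m * \sum_(0 <= j < m) (1 + 2 * alpha) ^+ j.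
Proof.
rewrite /xi2_formula addn0 subn0.
rewrite (eq_big_nat _ _ (F2 := fun j => 2 ^+ (m - 2) * (1 + 2 * alpha) ^+ j)).
  rewrite -mulr_sumr; field.
  by rewrite !expf_neq0 ?a_neq0 ?pnatr_eq0.
move=> j /andP[_ lt_jm]; rewrite -natr_sum sum_bin_rev; last by lia.
rewrite natrX -mulrA -exprD mulrC; congr (_ ^+ _ * _); lia.
Qed.

Lemma xi2_formula_boundary m :
  (1 + 2 * alpha) * xi2_formula m.+1 0 = xi2_formula m 0 + alpha.
Proof.
rewrite !xi2_formula0 big_nat_recr //= exprS; field.
by rewrite expf_neq0 // a_neq0.
Qed.

Lemma xi2_formula_bulk m n : (n < m)%N ->
  2 * xi2_formula m.+1 n.+1 = xi2_formula m n.+1 + xi2_formula m.+1 n.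
Proof.
move=> lt_nm; set a := 1 + 2 * alpha.
(* The prefactor, weights and binomial rows of [xi2_formula m.+1 n]; the other two terms are
   rewritten with them. *)
pose c := alpha / (2 ^+ (m + n - 1) * a ^+ m.+1).
pose w j : R := a ^+ j * 2 ^+ (m.+1 - j - 2).
pose N j := (m + n - 1 - (m.+1 - j - 2))%N.
have -> : 2 * xi2_formula m.+1 n.+1 = c * \sum_(0 <= j < m.+1)
    (w j * (\sum_(1 <= k < (m - n).+1) 'C((N j).+1, m.+1 - k))%N%:R).
  rewrite /xi2_formula mulrA; congr (_ * _).
    rewrite /c; have -> : (m.+1 + n.+1 - 2 = (m + n - 1).+1)%N by lia.
    by rewrite -/a [2 ^+ _.+1]exprS; field; rewrite !expf_neq0 ?a_neq0 ?pnatr_eq0.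
  apply: eq_big_nat => j /andP[_ lt_jm]; congr (_ * _).
  rewrite natr_sum subSS; apply: eq_bigr => k _; congr ('C(_, _)%:R); rewrite /N; lia.
(* Shifting [j] by one absorbs the extra factor [a]. The new term [j = 0] vanishes: [N 0 = n], while
   [m - k > n] throughout the range of [k]. *)
have -> : xi2_formula m n.+1 = c * \sum_(0 <= j < m.+1)
    (w j * (\sum_(1 <= k < m - n) 'C(N j, m - k))%N%:R).
  rewrite big_nat_recl //= [X in _ * X%:R + _]big_nat.
  rewrite [X in _ * X%:R + _]big1; last first.
    by move=> k /andP[k1 kmn]; rewrite bin_small // /N; lia.
  rewrite mulr0 add0r /xi2_formula.
  have -> : \sum_(0 <= i < m) w i.+1 * (\sum_(1 <= k < m - n) 'C(N i.+1, m - k))%:R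
     = a * \sum_(0 <= j < m) (a ^+ j * 2 ^+ (m - j - 2)
       * \sum_(1 <= k < (m - n.+1).+1)
           ('C((m + n.+1 - 2) - (m - j - 2), m - k))%:R).
    rewrite mulr_sumr; apply: eq_big_nat => j _.
    rewrite /w exprS subSS natr_sum -!mulrA; congr (_ * (_ * (_ * _))).
    have -> : (m - n.+1).+1 = (m - n)%N by lia.
    by apply: eq_bigr => k _; congr ('C(_, _)%:R); rewrite /N; lia.
  rewrite mulrA; congr (_ * _); rewrite /c -/a.
  have -> : (m + n.+1 - 2 = m + n - 1)%N by lia.
  by rewrite [a ^+ m.+1]exprS; field; rewrite !expf_neq0 ?a_neq0 ?pnatr_eq0.
have -> : xi2_formula m.+1 n = c * \sum_(0 <= j < m.+1)
    (w j * (\sum_(1 <= k < (m.+1 - n).+1) 'C(N j, m.+1 - k))%N%:R).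
  rewrite /xi2_formula; congr (_ * _).
  by apply: eq_big_nat => j _; rewrite natr_sum; congr (_ * _).
rewrite -mulrDr -big_split; congr (_ * _); apply: eq_bigr => j _ /=.
by rewrite sum_bin_pascal // natrD mulrDr.
Qed.

End ClosedForm.

(* The truncated subtraction of [nat] is the positive part [( _ )_+]. *)
Theorem theorem6 (R : realType) (L : nat) (alpha beta : R)
    (alpha_gt0 : 0 < alpha) (beta_gt0 : 0 < beta)
    (pi : config L -> R) (pi_stationary : stationary alpha beta pi) :
  (forall m n : nat, (n <= m)%N -> (m < L)%N ->
     expectation pi (xi2 R m n)
     = alpha / (2 ^+ (m + n - 2) * (1 + 2 * alpha) ^+ m)
       * \sum_(0 <= j < m)
           ((1 + 2 * alpha) ^+ j * 2 ^+ (m - j - 2)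
            * \sum_(1 <= k < (m - n).+1)
                ('C((m + n - 2) - (m - j - 2), m - k))%:R))
  /\ (forall m n : nat, (m < n)%N -> (n < L)%N ->
        forall eta : config L, xi2 R m n eta = xi2 R n m eta).
Proof.
split; last by move=> m n _ _ eta; exact: xi2_sym.
move=> m n le_nm lt_mL; rewrite -/(xi2_formula alpha m n).
(* Nested induction: the bulk recursion at [(m.+1, n.+1)] calls [(m, n.+1)] from the outer
   hypothesis and [(m.+1, n)] from the inner one, down to the line [n = 0] and the diagonal. *)
elim: m => [|m IHm] in n le_nm lt_mL *.
  move: le_nm; rewrite leqn0 => /eqP->.
  by rewrite expectation_xi2_diag xi2_formula_diag.
have two_neq0 : (2 : R) != 0 by rewrite pnatr_eq0.
have a_neq0 : 1 + 2 * alpha != 0 by rewrite lt0r_neq0 // addr_gt0 ?mulr_gt0.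
elim: n => [|n IHn] in le_nm *.
  apply: (mulfI a_neq0); rewrite (expectation_xi2_boundary pi_stationary lt_mL).
  by rewrite IHm ?xi2_formula_boundary // ltnW.
move: le_nm; rewrite leq_eqVlt => /predU1P[->|lt_nm].
  by rewrite expectation_xi2_diag xi2_formula_diag.
apply: (mulfI two_neq0).
rewrite (@expectation_xi2_bulk _ _ _ _ _ pi_stationary m n lt_nm lt_mL).
by rewrite xi2_formula_bulk // IHn ?IHm // ltnW // ltnW.
Qed.
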